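(* Let $p\ge 2$ and $1<\alpha<\min\{n,p\}$. Let $p^*=\frac{np}{n-\alpha}$ and $q=p\left(\frac{n+\frac{\alpha-1}{2}}{n-1}\right)$. There exists a constant $d_{n,p,\alpha}>0$, depending only on $n,p,\alpha$, such that for all $f\in C_c^\infty(\mathbb{R}^n_+)$, $$J_{\alpha,p}^{\mathbb{R}^n_+}(f)\;\ge\; d_{n,p,\alpha}\left(\int_{\mathbb{R}^n_+}|f(x)|^q\,x_n^{-n+nq/p^*}\,dx\right)^{p/q}.$$
   Context: $n$ is a positive integer (the hypothesis $1<\alpha<n$ forces $n\ge 2$). $\mathbb{R}^n_+=\{x=(x',x_n)\in\mathbb{R}^n: x'\in\mathbb{R}^{n-1},\ x_n>0\}$ is the upper halfspace, and $$J_{\alpha,p}^{\mathbb{R}^n_+}(f)=\int_{\mathbb{R}^n_+\times\mathbb{R}^n_+}\frac{\left|x_n^{(1-\alpha)/p}f(x)-y_n^{(1-\alpha)/p}f(y)\right|^p}{|x-y|^{n+\alpha}}\,\frac{dx}{x_n^{(1-\alpha)/2}}\,\frac{dy}{y_n^{(1-\alpha)/2}}.$$ *)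

(* Defs.v *)
From HB Require Import structures.
From mathcomp Require Import all_boot all_order all_algebra.
From mathcomp Require Import all_classical all_reals all_analysis.

Set Implicit Arguments.
Unset Strict Implicit.
Unset Printing Implicit Defensive.

Import Order.TTheory GRing.Theory Num.Theory.
Import numFieldNormedType.Exports.

Local Open Scope classical_set_scope.
Local Open Scope ring_scope.

(* The sigma-algebra on 'rV[R]_n is the one generated by the n coordinate
   functions, as for the library's n.-tuple R; it is the Borel sigma-algebra. *)
Section measurable_rV.
Context {R : realType} (n : nat).

Definition rV_coord (i : 'I_n) (x : 'rV[R]_n) : measurableTypeR R := x ord0 i.

Let rV_set0 : g_sigma_preimage rV_coord set0.
Proof. exact: sigma_algebra0. Qed.

Let rV_setC A : g_sigma_preimage rV_coord A -> g_sigma_preimage rV_coord (~` A).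
Proof. exact: sigma_algebraC. Qed.

Let rV_bigcup (F : (set 'rV[R]_n)^nat) :
  (forall i, g_sigma_preimage rV_coord (F i)) ->
  g_sigma_preimage rV_coord (\bigcup_i (F i)).
Proof. exact: sigma_algebra_bigcup. Qed.

HB.instance Definition _ := @isMeasurable.Build default_measure_display
  'rV[R]_n (g_sigma_preimage rV_coord) rV_set0 rV_setC rV_bigcup.

Lemma measurable_rV_coord (i : 'I_n) : measurable_fun [set: 'rV[R]_n] (rV_coord i).
Proof.
move=> _ Y mY; rewrite setTI; apply: sub_sigma_algebra => /=.
rewrite -bigcup_seq/=; exists i => /=; first by rewrite mem_index_enum.
by exists Y => //; rewrite setTI.
Qed.

Lemma measurable_fun_rVP d (T : measurableType d) (f : T -> 'rV[R]_n) :
  (forall i, measurable_fun [set: T] (rV_coord i \o f)) ->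
  measurable_fun [set: T] f.
Proof.
move=> mf _ Y.
suff : g_sigma_preimage rV_coord `<=` [set B | measurable (f @^-1` B)].
  by move=> h mY; rewrite setTI; exact: h.
apply: smallest_sub.
  split => [|A mA|F mF] /=.
  - by rewrite preimage_set0.
  - rewrite setTD -preimage_setC; exact: measurableC.
  - by rewrite preimage_bigcup; apply: bigcupT_measurable.
rewrite -bigcup_seq; apply: bigcup_sub => i _ A [B mB <-] /=.
by rewrite setTI -comp_preimage -[X in measurable X]setTI; exact: mf.
Qed.

End measurable_rV.

Section lebesgue_measure_rV.
Context {R : realType}.

Definition rV_cons n (z : measurableTypeR R * 'rV[R]_n) : 'rV[R]_n.+1 :=
  row_mx (const_mx z.1 : 'rV[R]_1) z.2.

Lemma rV_consE0 n (z : measurableTypeR R * 'rV[R]_n) : rV_cons z ord0 ord0 = z.1.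
Proof. by rewrite mxE; case: splitP => // j _; rewrite mxE. Qed.

Lemma rV_consES n (z : measurableTypeR R * 'rV[R]_n) (i : 'I_n) :
  rV_cons z ord0 (lift ord0 i) = z.2 ord0 i.
Proof.
rewrite mxE; case: splitP => [j|k]; first by rewrite ord1.
by move=> /= /eqP; rewrite /bump/= eqn_add2l => /eqP/val_inj ->.
Qed.

Lemma measurable_rV_cons n : measurable_fun setT (@rV_cons n).
Proof.
apply: measurable_fun_rVP => i; case: (unliftP ord0 i) => [j|] ->.
  rewrite (_ : _ \o _ = rV_coord j \o snd); last first.
    by apply/funext => z; exact: rV_consES.
  by apply: measurableT_comp => //; exact: measurable_rV_coord.
rewrite (_ : _ \o _ = fst) //.
by apply/funext => z; exact: rV_consE0.
Qed.

Definition rV_uncons n (x : 'rV[R]_n.+1) : measurableTypeR R * 'rV[R]_n :=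
  (x ord0 ord0, \row_i x ord0 (lift ord0 i)).

Lemma rV_consK n : cancel (@rV_cons n) (@rV_uncons n).
Proof.
move=> [a v]; rewrite /rV_uncons rV_consE0/=; congr pair.
by apply/rowP => i; rewrite mxE rV_consES.
Qed.

Lemma rV_unconsK n : cancel (@rV_uncons n) (@rV_cons n).
Proof.
move=> x; apply/rowP => i; case: (unliftP ord0 i) => [j|] ->.
  by rewrite rV_consES mxE.
by rewrite rV_consE0.
Qed.

Lemma measurable_rV_uncons n : measurable_fun setT (@rV_uncons n).
Proof.
apply: measurable_fun_pair; first exact: (measurable_rV_coord ord0).
apply: measurable_fun_rVP => i.
rewrite (_ : _ \o _ = rV_coord (lift ord0 i)); last first.
  by apply/funext => x /=; rewrite /rV_coord mxE.
exact: measurable_rV_coord.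
Qed.

Fixpoint lebesgue_rV (n : nat) : set 'rV[R]_n -> \bar R :=
  match n with
  | 0 => @dirac _ 'rV[R]_0 0 R
  | m.+1 => pushforward (lebesgue_measure \x (@lebesgue_rV m))%E (@rV_cons m)
  end.

Section lebesgue_rV_step.
Context (n : nat) (mu : {sigma_finite_measure set 'rV[R]_n -> \bar R}).

Definition lebesgue_rV_step : set 'rV[R]_n.+1 -> \bar R :=
  pushforward (lebesgue_measure \x mu)%E (@rV_cons n).
Local Notation nu := lebesgue_rV_step.

Let nu0 : nu set0 = 0%E.
Proof. by rewrite /lebesgue_rV_step /pushforward preimage_set0 measure0. Qed.

Let nu_ge0 A : (0 <= nu A)%E.
Proof. exact: (@measure_ge0 _ _ _ (lebesgue_measure \x mu)%E). Qed.

Let nu_sigma_additive : semi_sigma_additive nu.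
Proof.
pose m : {measure set 'rV[R]_n.+1 -> \bar R} :=
  pushforward (lebesgue_measure \x mu)%E (@rV_cons n).
exact: (@measure_semi_sigma_additive _ _ _ (m (@measurable_rV_cons n))).
Qed.

HB.instance Definition _ :=
  isMeasure.Build _ _ _ nu nu0 nu_ge0 nu_sigma_additive.

Let lebesgueR : {sigma_finite_measure set (measurableTypeR R) -> \bar R} :=
  @lebesgue_measure R.

Lemma lebesgue_rV_step_boxE (A : set (measurableTypeR R)) (B : set 'rV[R]_n) :
  measurable A -> measurable B ->
  nu (@rV_uncons n @^-1` (A `*` B)) = (lebesgue_measure A * mu B)%E.
Proof.
move=> mA mB; rewrite /lebesgue_rV_step /pushforward -comp_preimage.
rewrite (_ : _ \o _ = id) ?preimage_id; last first.
  by apply/funext => z /=; exact: rV_consK.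
exact: (@product_measure1E _ _ _ _ _ lebesgueR).
Qed.

Lemma lebesgue_rV_step_sigma_finite : sigma_finite setT nu.
Proof.
have /sigma_finiteP[F [TF ndF Foo]] := sigma_finiteT lebesgueR.
have /sigma_finiteP[G [TG ndG Goo]] := sigma_finiteT mu.
exists (fun k => @rV_uncons n @^-1` (F k `*` G k)).
  rewrite -preimage_bigcup -(preimage_setT (@rV_uncons n)); congr preimage.
  rewrite -setXTT TF TG predeqE => -[x y]; split.
    move=> [/= [k _ Fkx] [l _ Gly]]; exists (maxn k l) => //; split.
    - by move: x Fkx; exact/subsetPset/ndF/leq_maxl.
    - by move: y Gly; exact/subsetPset/ndG/leq_maxr.
  by move=> [k _ []/= ? ?]; split; exists k.
move=> k; have [mF Fk] := Foo k; have [mG Gk] := Goo k; split.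
  rewrite -[X in measurable X]setTI; apply: measurable_rV_uncons => //.
  exact: measurableX.
by rewrite lebesgue_rV_step_boxE// lte_mul_pinfty// ge0_fin_numE.
Qed.

HB.instance Definition _ :=
  Measure_isSigmaFinite.Build _ _ _ nu lebesgue_rV_step_sigma_finite.

End lebesgue_rV_step.

Lemma lebesgue_rV_sigma_finite_measure n :
  {mu : {sigma_finite_measure set 'rV[R]_n -> \bar R} |
    mu = @lebesgue_rV n :> (set _ -> \bar R)}.
Proof.
elim: n => [|n [mu muE]].
  by exists (@dirac _ 'rV[R]_0 0 R).
by exists (lebesgue_rV_step mu); rewrite /= -muE.
Qed.

Section lebesgue_rV_instance.
Context (n : nat).

Let m := @lebesgue_rV n.
Let P := lebesgue_rV_sigma_finite_measure n.

Let m0 : m set0 = 0%E. Proof. by rewrite /m -(projT2 P) measure0. Qed.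
Let m_ge0 A : (0 <= m A)%E. Proof. by rewrite /m -(projT2 P). Qed.
Let m_sigma_additive : semi_sigma_additive m.
Proof. by rewrite /m -(projT2 P); exact: measure_semi_sigma_additive. Qed.

HB.instance Definition _ := isMeasure.Build _ _ _ (@lebesgue_rV n)
  m0 m_ge0 m_sigma_additive.

Let m_sigma_finite : sigma_finite setT m.
Proof. by rewrite /m -(projT2 P); exact: sigma_finiteT. Qed.

HB.instance Definition _ := Measure_isSigmaFinite.Build _ _ _ (@lebesgue_rV n)
  m_sigma_finite.

End lebesgue_rV_instance.

End lebesgue_measure_rV.
Arguments lebesgue_rV {R} n.

Lemma lebesgue_rV_box (R : realType) n (A : 'I_n -> set (measurableTypeR R)) :
  (forall i, measurable (A i)) ->
  lebesgue_rV n [set x | forall i, A i (x ord0 i)] =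
  (\prod_(i < n) lebesgue_measure (A i))%E.
Proof.
elim: n A => [|n IH] A mA.
  rewrite big_ord0 /= diracE mem_set//.
  by case.
have mB : measurable [set x : 'rV[R]_n | forall i, A (lift ord0 i) (x ord0 i)].
  have -> : [set x : 'rV[R]_n | forall i, A (lift ord0 i) (x ord0 i)] =
      \big[setI/setT]_(i < n) (rV_coord i @^-1` A (lift ord0 i)).
    rewrite -bigcap_seq; apply/seteqP; split => x /= h.
      by move=> i _; exact: h.
    by move=> i; apply: h; rewrite /= mem_index_enum.
  apply: bigsetI_measurable => i _.
  by rewrite -[X in measurable X]setTI; exact: measurable_rV_coord.
rewrite big_ord_recl -(IH (fun i => A (lift ord0 i)))//.
rewrite -lebesgue_rV_step_boxE//.
congr (_ _); apply/seteqP; split => x /=.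
  by move=> h; split => // i; rewrite mxE; exact: h.
move=> [h0 h] i; case: (unliftP ord0 i) => [j|] -> //.
by have := h j; rewrite mxE.
Qed.

Section smooth_compact_support.
Context {R : realType} (n : nat).
Implicit Types (f : 'rV[R]_n.+1 -> R) (Omega : set 'rV[R]_n.+1).

(* iter_partial [:: i1; ...; ik] f = d_i1 (d_i2 (... (d_ik f))) *)
Definition iter_partial (s : seq 'I_n.+1) f : 'rV[R]_n.+1 -> R :=
  foldr (fun i g => 'D_(delta_mx ord0 i) g) f s.

Definition smooth f : Prop := forall s : seq 'I_n.+1,
  continuous (iter_partial s f) /\
  forall (i : 'I_n.+1) x, derivable (iter_partial s f) x (delta_mx ord0 i).

Definition supp f : set 'rV[R]_n.+1 := closure [set x | f x != 0].

(* Elements of C_c^oo(Omega) are represented by their extensions by zero to the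
   whole space. *)
Definition Cc_infty Omega f : Prop :=
  [/\ smooth f, compact (supp f) & supp f `<=` Omega].

End smooth_compact_support.

Section halfspace.
Context {R : realType}.

(* The library norm on 'rV[R]_n is the sup norm. *)
Definition enorm n (x : 'rV[R]_n) : R := Num.sqrt (\sum_(i < n) x ord0 i ^+ 2).

(* The ambient dimension is n.+1. *)
Definition last_coord n (x : 'rV[R]_n.+1) : R := x ord0 ord_max.

Definition halfspace n : set 'rV[R]_n.+1 := [set x | 0 < last_coord x].

Definition J_halfspace n (alpha p : R) (f : 'rV[R]_n.+1 -> R) : \bar R :=
  (\int[lebesgue_rV n.+1 \x lebesgue_rV n.+1]_(z in @halfspace n `*` @halfspace n)
    (let x := z.1 in let y := z.2 in
     `|last_coord x `^ ((1 - alpha) / p) * f x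
       - last_coord y `^ ((1 - alpha) / p) * f y| `^ p
     / enorm (x - y) `^ (n.+1%:R + alpha)
     / last_coord x `^ ((1 - alpha) / 2)
     / last_coord y `^ ((1 - alpha) / 2))%:E)%E.

End halfspace.
Arguments halfspace {R} n.

(* Main.v *)
Require Import Defs.
From mathcomp Require Import all_boot all_order all_algebra.
From mathcomp Require Import all_classical all_reals all_analysis.
From mathcomp Require Import measurable_realfun ring lra.

Import Order.TTheory GRing.Theory Num.Theory.
Import numFieldNormedType.Exports.

Local Open Scope classical_set_scope.
Local Open Scope ring_scope.

(* Put s = (alpha - 1) / 2, w(x) = x_n^s on the half-space, and
   g(x) = x_n^((1 - alpha) / p) f(x).  Then J(f) is the Gagliardo seminorm
     \int\int |g(x) - g(y)|^p / |x - y|^(D + sigma) w(x) w(y) dx dy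
   with D = n + s and sigma = 1 + s, and the right-hand side is the norm of g
   in L^q(w) for q = p D / (D - sigma): the claim is the fractional Sobolev
   inequality for the measure w dx, which satisfies w(B(x, r)) >= c r^D.
   For a measure with that lower bound, put I = \int |g|^q w and t = |g(x)| > 0.
   Every y satisfies |g(y)| >= t/2 or |g(x) - g(y)| >= t/2, so that
     1 <= (2/t)^q |g(y)|^q + (2/t)^p |g(x) - g(y)|^p.
   Integrating over B(x, r) with c r^D = 2 (2/t)^q I, the first term accounts
   for at most half of c r^D, and the second one yields
     \int |g(x) - g(y)|^p / |x - y|^(D + sigma) w(y) dy
       >= C I^(- sigma / D) |g(x)|^q;
   integrating in x gives C I^(1 - sigma / D) = C I^(p / q).  This needs I to be
   finite, which the compact support of f ensures. *)

(** * Real powers *)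

Lemma powRD_gt0 (R : realType) (x r s : R) : 0 < x ->
  x `^ (r + s) = x `^ r * x `^ s.
Proof. by move=> x0; rewrite powRD// (gt_eqF x0) implybT. Qed.

Lemma powR_half_dichotomy (R : realType) (p q a b : R) :
  0 <= p -> 0 <= q -> a != 0 ->
  1 <= (2 / `|a|) `^ q * `|b| `^ q + (2 / `|a|) `^ p * `|a - b| `^ p.
Proof.
move=> p0 q0 a0.
have a_gt0 : 0 < `|a| by rewrite normr_gt0.
have ge1 e u : 0 <= e -> `|a| / 2 <= u -> 1 <= (2 / `|a|) `^ e * u `^ e.
  move=> e0 ua.
  have u0 : 0 <= u by apply: le_trans ua; rewrite divr_ge0.
  rewrite -powRM ?divr_ge0//.
  apply: (@le_trans _ _ (1 `^ e)); first by rewrite powR1.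
  apply: ge0_ler_powR => //; rewrite ?nnegrE ?mulr_ge0 ?divr_ge0//.
  by rewrite mulrAC ler_pdivlMr// mul1r mulrC -ler_pdivrMr.
have [ba|ba] := leP (`|a| / 2) `|b|.
  by apply: le_trans (ge1 _ _ q0 ba) _; rewrite lerDl mulr_ge0 ?powR_ge0.
have ab : `|a| / 2 <= `|a - b|.
  have := ler_distD b a 0; rewrite !subr0 => h; lra.
by apply: le_trans (ge1 _ _ p0 ab) _; rewrite lerDr mulr_ge0 ?powR_ge0.
Qed.

(** * Fractional Sobolev inequality under a lower bound on the mass of balls *)

Section fractional_sobolev.
Context {d : measure_display} {T : measurableType d} {R : realType}.
Variables (mu : {sigma_finite_measure set T -> \bar R}).
Variables (w : T -> R) (dist : T * T -> R) (c D sigma p : R).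
Hypotheses (mw : measurable_fun setT w) (w0 : forall x, 0 <= w x).
Hypotheses (mdist : measurable_fun setT dist).
Hypotheses (c0 : 0 < c) (p0 : 0 < p) (sigma0 : 0 < sigma) (sigmaD : sigma < D).
(** [B] may be any measurable part of the ball of radius r about x. The bound 0 < dist keeps it off
    the zeros of [dist], where the kernel is 0 by the convention 1/0 = 0. *)
Hypothesis ball_ge : forall x r, 0 < w x -> 0 < r -> exists B : set T,
  [/\ measurable B, (forall y, B y -> 0 < dist (x, y) <= r) &
   ((c * r `^ D)%:E <= \int[mu]_(y in B) (w y)%:E)%E].

(** The Sobolev exponent in dimension D: p / q = 1 - sigma / D. *)
Let q := p * (D / (D - sigma)).
Let K (g : T -> R) (z : T * T) : R :=
  `|g z.1 - g z.2| `^ p / dist z `^ (D + sigma) * w z.1 * w z.2.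
Let C := c / 2 * 2 `^ (- p) * (2 * 2 `^ q / c) `^ (- (sigma / D)).

Let D_gt0 : 0 < D. Proof. exact: lt_trans sigma0 sigmaD. Qed.

Let Dsigma_gt0 : 0 < D - sigma. Proof. by rewrite subr_gt0. Qed.

Let q0 : 0 < q. Proof. by rewrite mulr_gt0 ?divr_gt0. Qed.

Let K_ge0 g z : 0 <= K g z.
Proof. by rewrite /K !mulr_ge0 ?invr_ge0 ?powR_ge0. Qed.

Let measurable_K g : measurable_fun setT g -> measurable_fun setT (K g).
Proof.
move=> mg; rewrite /K.
apply: measurable_funM; last exact: measurableT_comp.
apply: measurable_funM; last exact: measurableT_comp.
apply: measurable_funM.
  apply: (measurableT_comp (measurable_powR p)).
  apply: measurableT_comp => //.
  by apply: measurable_funB; exact: measurableT_comp.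
under eq_fun do rewrite -powRN.
exact: (measurableT_comp (measurable_powR _)).
Qed.

(** The radius solves c r^D = 2 (2/t)^q I. Cancelling r^D on the right leaves r^(- sigma), which
    supplies powers of I and t; those of t add up because p + q sigma / D = q. [C] gathers the
    remaining factors. *)
Let constantE I t r : 0 < I -> 0 < t ->
  r = (2 / c * ((2 / t) `^ q * I)) `^ D^-1 ->
  C * I `^ (- (sigma / D)) * t `^ q =
  c * r `^ D / 2 / ((2 / t) `^ p * r `^ (D + sigma)).
Proof.
move=> I0 t0 rE.
have D0 : D != 0 by rewrite gt_eqF.
have inv2t e : (2 / t) `^ e = 2 `^ e * t `^ (- e).
  by rewrite powRM ?invr_ge0 ?ltW// -(powR_inv1 (ltW t0)) -powRrM mulN1r.
have r0 : 0 < r.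
  by rewrite rE powR_gt0// !mulr_gt0 ?powR_gt0 ?divr_gt0 ?invr_gt0.
have rsigma : (r `^ sigma)^-1 =
    (2 * 2 `^ q / c) `^ (- (sigma / D)) * t `^ (q * (sigma / D)) *
    I `^ (- (sigma / D)).
  rewrite -powRN rE -powRrM inv2t.
  have -> : 2 / c * (2 `^ q * t `^ (- q) * I) =
    2 * 2 `^ q / c * t `^ (- q) * I by ring.
  have -> : D^-1 * - sigma = - (sigma / D) by ring.
  have : 0 <= 2 * 2 `^ q / c by rewrite !mulr_ge0 ?invr_ge0 ?powR_ge0 ?ltW.
  move: (2 * 2 `^ q / c) => k k0.
  by rewrite !powRM ?mulr_ge0 ?powR_ge0 ?(ltW I0)// -powRrM mulrNN.
have tq : t `^ q = t `^ p * t `^ (q * (sigma / D)).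
  rewrite -powRD_gt0//.
  congr powR; rewrite /q; field; by rewrite D0/= gt_eqF.
rewrite powRD_gt0// inv2t tq.
have -> : c * r `^ D / 2 / (2 `^ p * t `^ (- p) * (r `^ D * r `^ sigma)) =
   c / 2 * (2 `^ p)^-1 * (t `^ (- p))^-1 * (r `^ sigma)^-1.
  by field; rewrite !gt_eqF// powR_gt0.
by rewrite rsigma -!powRN opprK /C; ring.
Qed.

Let inner_integral_ge (g : T -> R) x I : measurable_fun setT g -> 0 < I ->
  (\int[mu]_y (`|g y| `^ q * w y)%:E = I%:E)%E ->
  ((C * I `^ (- (sigma / D)) * (`|g x| `^ q * w x))%:E <=
   \int[mu]_y (K g (x, y))%:E)%E.
Proof.
move=> mg I0 IE.
(* Where g x or w x is 0 the left-hand side is 0; afterwards division by t and by w x is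
   legitimate. *)
have [gx0|gx0] := eqVneq (g x) 0.
  rewrite gx0 normr0 powR0 ?gt_eqF// mul0r mulr0.
  by apply: integral_ge0 => y _; rewrite lee_fin.
have [wx0|wx0] := eqVneq (w x) 0.
  rewrite wx0 !mulr0; by apply: integral_ge0 => y _; rewrite lee_fin.
have {}wx0 : 0 < w x by rewrite lt_neqAle eq_sym wx0 w0.
set t := `|g x|.
have t0 : 0 < t by rewrite normr_gt0.
set r := (2 / c * ((2 / t) `^ q * I)) `^ D^-1.
have r0 : 0 < r.
  by rewrite powR_gt0 ?mulr_gt0 ?powR_gt0 ?divr_gt0 ?mulr_gt0 ?invr_gt0 ?mulr_gt0.
have rD : (2 / t) `^ q * I = c * r `^ D / 2.
  rewrite /r -powRrM mulVf ?powRr1; last 2 first.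
  - by rewrite !mulr_ge0 ?powR_ge0// ?invr_ge0 ltW.
  - by rewrite gt_eqF.
  by field; rewrite gt_eqF.
have [B [mB distB wB]] := ball_ge _ _ wx0 r0.
set k := (2 / t) `^ p * r `^ (D + sigma).
have k0 : 0 < k by apply: mulr_gt0; apply: powR_gt0 => //; exact: divr_gt0.
(* [F] and [G] come from the two terms of the dichotomy, times w y. In [G], the factor r^(D + sigma)
   of [k] compensates the denominator of [K]: on [B] one has r / dist >= 1, so the dichotomy still
   yields w <= F + G. *)
pose F y := (2 / t) `^ q * (`|g y| `^ q * w y).
pose G y := k * (K g (x, y) / w x).
have mF : measurable_fun setT F.
  apply: measurable_funM => //; apply: measurable_funM => //.
  by apply: (measurableT_comp (measurable_powR q)); exact: measurableT_comp.
have mKx : measurable_fun setT (fun y => K g (x, y)).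
  by apply: measurableT_comp (measurable_pair1 x) => //; exact: measurable_K.
have mG : measurable_fun setT G.
  by apply: measurable_funM => //; apply: measurable_funM.
have F0 y : 0 <= F y by rewrite /F !mulr_ge0 ?powR_ge0.
have G0 y : 0 <= G y by apply: mulr_ge0; [exact: ltW|exact: divr_ge0].
have wFG y : B y -> w y <= F y + G y.
  move=> /distB /andP[d0 dr].
  have -> : F y + G y = w y * ((2 / t) `^ q * `|g y| `^ q +
     (2 / t) `^ p * `|g x - g y| `^ p *
     (r `^ (D + sigma) / dist (x, y) `^ (D + sigma))).
    rewrite /F /G /k /K/=; field.
    by rewrite !gt_eqF// powR_gt0.
  have dich := powR_half_dichotomy _ _ _ _ (g y) (ltW p0) (ltW q0) gx0.
  rewrite ler_peMr// (le_trans dich)//.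
  rewrite lerD2l ler_peMr ?mulr_ge0 ?powR_ge0//.
  rewrite ler_pdivlMr ?powR_gt0// mul1r.
  by apply: ge0_ler_powR => //; rewrite ?nnegrE ?addr_ge0//; exact: ltW.
(* Integrate over [B], then enlarge [B] to the whole space: there [F] has integral (2/t)^q I, which
   is half of c r^D. *)
have h : ((c * r `^ D)%:E <= (c * r `^ D / 2)%:E +
    (k / w x)%:E * \int[mu]_y (K g (x, y))%:E)%E.
  apply: (le_trans wB).
  apply: (@le_trans _ _ (\int[mu]_(y in B) ((F y)%:E + (G y)%:E))%E).
    apply: ge0_le_integral => //.
    - by move=> y _; rewrite lee_fin.
    - by apply/measurable_funTS/measurable_EFinP.
    - apply: emeasurable_funD; by apply/measurable_funTS/measurable_EFinP.
  apply: (@le_trans _ _ (\int[mu]_y ((F y)%:E + (G y)%:E))%E).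
    apply: ge0_subset_integral => //.
      by apply: emeasurable_funD; apply/measurable_EFinP.
    by move=> y _; rewrite -EFinD lee_fin addr_ge0.
  rewrite ge0_integralD//; last 4 first.
  - by move=> y _; rewrite lee_fin.
  - exact/measurable_EFinP.
  - by move=> y _; rewrite lee_fin.
  - exact/measurable_EFinP.
  apply: leeD.
    under eq_integral do rewrite EFinM.
    rewrite ge0_integralZl_EFin ?powR_ge0//; last 2 first.
    - by move=> y _; rewrite lee_fin mulr_ge0 ?powR_ge0.
    - apply/measurable_EFinP; apply: measurable_funM => //.
      by apply: (measurableT_comp (measurable_powR q)); exact: measurableT_comp.
    by rewrite IE -EFinM rD.
  under eq_integral do rewrite /G mulrCA mulrC EFinM.
  rewrite ge0_integralZl_EFin//.
  - by move=> y _; rewrite lee_fin.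
  - exact/measurable_EFinP.
  - by rewrite divr_ge0 ?ltW.
have kw0 : 0 < k / w x by rewrite divr_gt0.
(* Only the finite half is subtracted, so the kernel integral may be infinite. *)
have : ((c * r `^ D / 2)%:E <= (k / w x)%:E * \int[mu]_y (K g (x, y))%:E)%E.
  move: h; rewrite -leeBlDl// -EFinB.
  by have -> : c * r `^ D - c * r `^ D / 2 = c * r `^ D / 2 by lra.
rewrite -lee_pdivrMl// -EFinM; apply: le_trans; rewrite lee_fin.
rewrite mulrA (constantE _ _ _ I0 t0 erefl) -/r -/k invf_div.
by rewrite le_eqVlt; apply/orP; left; apply/eqP; field; rewrite ?gt_eqF//.
Qed.

Lemma fractional_sobolev : exists e : R, 0 < e /\
  forall g : T -> R, measurable_fun setT g ->
    (\int[mu]_y (`|g y| `^ q * w y)%:E < +oo)%E ->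
    (e%:E * (\int[mu]_y (`|g y| `^ q * w y)%:E) `^ (p / q) <=
     \int[mu \x mu]_z (`|g z.1 - g z.2| `^ p / dist z `^ (D + sigma) *
                        w z.1 * w z.2)%:E)%E.
Proof.
have C0 : 0 < C.
  by rewrite !mulr_gt0 ?powR_gt0 ?divr_gt0 ?mulr_gt0 ?powR_gt0 ?invr_gt0.
exists C; split => // g mg.
set J := (X in (_ -> _ <= X)%E).
have J0 : (0 <= J)%E by apply: integral_ge0 => z _; rewrite lee_fin K_ge0.
have mgw : measurable_fun setT (fun y => (`|g y| `^ q * w y)%:E).
  apply/measurable_EFinP; apply: measurable_funM => //.
  by apply: (measurableT_comp (measurable_powR q)); exact: measurableT_comp.
have : (0 <= \int[mu]_y (`|g y| `^ q * w y)%:E)%E.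
  by apply: integral_ge0 => y _; rewrite lee_fin mulr_ge0 ?powR_ge0.
case IE : (\int[mu]_y (`|g y| `^ q * w y)%:E)%E => [I| |]//.
rewrite lee_fin => I0 _.
rewrite poweR_EFin -EFinM.
(* For I = 0 the left-hand side is 0, as p / q > 0; otherwise the radius in the inner bound is
   positive. *)
have [->|In0] := eqVneq I 0.
  by rewrite powR0 ?mulr0// gt_eqF ?divr_gt0.
have {In0}I0 : 0 < I by rewrite lt_neqAle eq_sym In0.
(* Writing the left-hand side as an integral in x, by p / q = 1 - sigma / D, leaves a pointwise
   comparison with the inner integrals given by Tonelli. *)
have -> : (C * I `^ (p / q))%:E =
    (\int[mu]_x (C * I `^ (- (sigma / D)) * (`|g x| `^ q * w x))%:E)%E.
  under eq_integral do rewrite EFinM.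
  rewrite ge0_integralZl_EFin//; last 2 first.
  - by move=> y _; rewrite lee_fin mulr_ge0 ?powR_ge0.
  - by rewrite mulr_ge0 ?powR_ge0// ltW.
  rewrite IE -EFinM.
  suff -> : I `^ (p / q) = I `^ (- (sigma / D)) * I by rewrite mulrA.
  rewrite -[X in _ = _ * X](powRr1 (ltW I0)) -powRD_gt0//.
  congr powR; rewrite /q; field.
  by rewrite !gt_eqF.
rewrite /J fubini_tonelli1//; last 2 first.
- by apply/measurable_EFinP; exact: measurable_K.
- by move=> z; rewrite lee_fin K_ge0.
apply: ge0_le_integral => //.
- by move=> x _; rewrite lee_fin !mulr_ge0 ?powR_ge0// ltW.
- under eq_fun do rewrite EFinM; exact: measurable_funeM.
- apply: measurable_fun_fubini_tonelli_F => //.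
    by apply/measurable_EFinP; exact: measurable_K.
  by move=> z; rewrite lee_fin K_ge0.
- by move=> x _; exact: inner_integral_ge.
Qed.

End fractional_sobolev.

(** * Measurability of boxes, open sets and continuous functions on row vectors *)

Lemma measurable_rV_box (R : realType) n (A : 'I_n -> set (measurableTypeR R)) :
  (forall i, measurable (A i)) ->
  measurable [set x : 'rV[R]_n | forall i, A i (x ord0 i)].
Proof.
move=> mA.
have -> : [set x : 'rV[R]_n | forall i, A i (x ord0 i)] =
    \bigcap_(i in [set: 'I_n]) (rV_coord i @^-1` A i).
  by apply/seteqP; split => x /= h; [move=> i _; exact: h|move=> i; exact: h].
apply: fin_bigcap_measurable => // i _.
by rewrite -[X in measurable X]setTI; exact: measurable_rV_coord.
Qed.

(* An open set is the union of the countably many boxes with rational vertices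
   that it contains. *)
Lemma open_measurable_rV (R : realType) n (U : set 'rV[R]_n) :
  open U -> measurable U.
Proof.
move=> oU.
pose box (b : {ffun 'I_n -> rat * rat}) : set 'rV[R]_n :=
  [set x | forall i, `]ratr (b i).1, ratr (b i).2[%classic (x ord0 i)].
have -> : U = \bigcup_b (if `[< box b `<=` U >] then box b else set0).
  apply/seteqP; split => [x Ux|x [b _]]; last by case: asboolP => // bU /bU.
  have /nbhs_ballP[e /= e0 eU] := open_nbhs_nbhs (conj oU Ux).
  have lo i : x ord0 i - e < x ord0 i by rewrite ltrBlDr ltrDl.
  have hi i : x ord0 i < x ord0 i + e by rewrite ltrDl.
  (* In each coordinate, one rational within e on each side of x: the box contains x and lies in the
     ball, which is a cube for the sup norm. *)
  pose b := [ffun i => (sval (cid (rat_in_itvoo (lo i))),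
                        sval (cid (rat_in_itvoo (hi i))))].
  have bP i : [/\ x ord0 i - e < ratr (b i).1, ratr (b i).1 < x ord0 i,
      x ord0 i < ratr (b i).2 & ratr (b i).2 < x ord0 i + e].
    rewrite ffunE/=; case: cid => /= u; case: cid => /= v.
    by rewrite !in_itv/= => /andP[? ?] /andP[? ?].
  exists b => //; rewrite asboolT.
    by move=> i; rewrite /= in_itv/=; have [_ -> -> _] := bP i.
  move=> y /= xy; apply: eU; split => // i j; rewrite ord1.
  have := xy j; have [h1 _ _ h2] := bP j; rewrite /= in_itv/= => /andP[h3 h4].
  by rewrite -ball_normE/= distrC ltr_distl (lt_trans h1 h3) (lt_trans h4 h2).
apply: countable_bigcupT_measurable => [|b]; first exact: countableP.
case: asboolP => // _.
exact: (@measurable_rV_box R n (fun i => `]ratr (b i).1, ratr (b i).2[%classic)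
  (fun i => measurable_itv _)).
Qed.

(** Open intervals generate the Borel sets of the line, and their preimages under f are open. *)
Lemma continuous_measurable_rV (R : realType) n (f : 'rV[R]_n -> R) :
  continuous f -> measurable_fun setT f.
Proof.
move=> /continuousP cf; apply: (measurability _ (RGenOpens.measurableE R)).
move=> _ [_ [a [b ->] <-]]; rewrite setTI; apply: open_measurable_rV.
exact/cf/interval_open.
Qed.

Lemma measurable_enormB (R : realType) n :
  measurable_fun setT (fun z : 'rV[R]_n * 'rV[R]_n => enorm (z.1 - z.2)).
Proof.
apply: (measurableT_comp (continuous_measurable_fun (@sqrt_continuous R))).
apply: measurable_sum => i; apply: measurable_funX.
under eq_fun do rewrite mxE mxE.
by apply: measurable_funB; apply: (measurableT_comp (measurable_rV_coord i)).
Qed.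

Lemma measurable_last_coord (R : realType) n :
  measurable_fun setT (@last_coord R n).
Proof. exact: measurable_rV_coord. Qed.

Lemma measurable_halfspace (R : realType) n : measurable (@halfspace R n).
Proof.
have -> : @halfspace R n = @last_coord R n @^-1` `]0, +oo[%classic.
  by apply/seteqP; split => x; rewrite /halfspace/= in_itv/= andbT.
by rewrite -[X in measurable X]setTI; exact: measurable_last_coord.
Qed.

(** * Euclidean norm bounds and the weight on the half-space *)

Lemma enorm_gt0 (R : realType) n (x : 'rV[R]_n) (i : 'I_n) :
  x ord0 i != 0 -> 0 < enorm x.
Proof.
move=> xi; rewrite sqrtr_gt0 (bigD1 i)//= ltr_wpDr//.
  by apply: sumr_ge0 => j _; exact: sqr_ge0.
by rewrite exprn_even_gt0.
Qed.

Lemma enorm_le (R : realType) n (x : 'rV[R]_n) (a : R) : 0 <= a ->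
  (forall i, `|x ord0 i| <= a) -> enorm x <= Num.sqrt n%:R * a.
Proof.
move=> a0 xa; rewrite -[X in _ * X](ger0_norm a0) -sqrtr_sqr -sqrtrM//.
apply: ler_wsqrtr; rewrite mulr_natl -[X in _ <= _ *+ X]card_ord -sumr_const.
apply: ler_sum => i _; rewrite -real_normK ?num_real//.
by rewrite ler_sqr ?nnegrE.
Qed.

(** The indicator extends the weight by zero, turning integrals over the half-space into integrals
    over the whole space. *)
Definition halfspace_weight (R : realType) n (s : R) (x : 'rV[R]_n.+1) : R :=
  \1_(@halfspace R n) x * last_coord x `^ s.
Arguments halfspace_weight {R n}.

Lemma halfspace_weightE (R : realType) n (s : R) (x : 'rV[R]_n.+1) :
  halfspace n x -> halfspace_weight s x = last_coord x `^ s.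
Proof. by move=> Hx; rewrite /halfspace_weight indicE mem_set// mul1r. Qed.

Lemma halfspace_weight_out (R : realType) n (s : R) (x : 'rV[R]_n.+1) :
  ~ halfspace n x -> halfspace_weight s x = 0.
Proof. by move=> Hx; rewrite /halfspace_weight indicE memNset// mul0r. Qed.

Lemma halfspace_weight_ge0 (R : realType) n (s : R) (x : 'rV[R]_n.+1) :
  0 <= halfspace_weight s x.
Proof. by rewrite mulr_ge0// powR_ge0. Qed.

Lemma measurable_halfspace_weight (R : realType) n (s : R) :
  measurable_fun setT (@halfspace_weight R n s).
Proof.
apply: measurable_funM.
  apply: measurable_indic; exact: measurable_halfspace.
exact: (measurableT_comp (measurable_powR s) (measurable_last_coord _ _)).
Qed.

(** The set is the cube with sides [x_i + rho, x_i + 2 rho], where rho = r / (2 sqrt(n + 1)). The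
    shift keeps it off x and, in the last coordinate, at height at least rho, where the weight is at
    least rho^s as s >= 0. Its points are within sqrt(n + 1) 2 rho = r of x, and its volume is
    rho^(n + 1). *)
Lemma halfspace_weight_ball (R : realType) n (s : R) (x : 'rV[R]_n.+1) (r : R) :
  0 <= s -> 0 < halfspace_weight s x -> 0 < r -> exists B : set 'rV[R]_n.+1,
  [/\ measurable B, (forall y, B y -> 0 < enorm (x - y) <= r) &
   ((((2 * Num.sqrt n.+1%:R)^-1 `^ (n.+1%:R + s)) * r `^ (n.+1%:R + s))%:E <=
    \int[lebesgue_rV n.+1]_(y in B) (halfspace_weight s y)%:E)%E].
Proof.
move=> s0 wx r0.
have Hx : halfspace n x.
  by apply: contrapT => Hx; move: wx; rewrite halfspace_weight_out// ltxx.
set k := 2 * Num.sqrt n.+1%:R.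
have k0 : 0 < k by rewrite mulr_gt0// sqrtr_gt0.
pose rho := k^-1 * r.
have rho0 : 0 < rho by rewrite mulr_gt0// invr_gt0.
pose I i : set (measurableTypeR R) :=
  `[x ord0 i + rho, x ord0 i + 2 * rho]%classic.
have mI i : measurable (I i) by exact: measurable_itv.
exists [set y | forall i, I i (y ord0 i)]; split.
- exact: measurable_rV_box.
- move=> y yB.
  have {}yB i : rho <= y ord0 i - x ord0 i <= 2 * rho.
    by have := yB i; rewrite /I/= in_itv/= lerBrDl lerBlDl.
  apply/andP; split.
    apply: (@enorm_gt0 _ _ _ ord0); rewrite !mxE subr_eq0.
    have /andP[h _] := yB ord0; apply/negP => /eqP xy.
    by move: h; rewrite xy subrr leNgt rho0.
  apply: (@le_trans _ _ (Num.sqrt n.+1%:R * (2 * rho))); last first.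
    rewrite /rho !mulrA [Num.sqrt _ * 2]mulrC -/k divff ?mul1r// gt_eqF//.
  apply: enorm_le => [|i]; first by rewrite mulr_ge0// ltW.
  have /andP[h1 h2] := yB i; rewrite !mxE distrC ger0_norm//.
  exact: le_trans (ltW rho0) h1.
- have muB : lebesgue_rV n.+1 [set y | forall i, I i (y ord0 i)] =
      (rho ^+ n.+1)%:E.
    rewrite (lebesgue_rV_box mI).
    under eq_bigr => i _.
      rewrite /I lebesgue_measure_itv/= lte_fin ltrD2l ltr_pMl// ltr1n.
      rewrite -EFinB (_ : _ - _ = rho); last by ring.
      over.
    by rewrite prodEFin prodr_const card_ord.
  have -> : (k^-1 `^ (n.+1%:R + s) * r `^ (n.+1%:R + s))%:E =
      (\int[lebesgue_rV n.+1]_(y in [set y | forall i, I i (y ord0 i)])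
        cst (rho `^ s)%:E y)%E.
    rewrite integral_cst; last exact: measurable_rV_box.
    rewrite [X in (_ * X)%E]muB -EFinM -powR_mulrn; last exact: ltW.
    rewrite -powRM ?invr_ge0; [|exact: ltW|exact: ltW].
    by rewrite -/rho powRD_gt0// mulrC.
  apply: ge0_le_integral => //.
  + exact: measurable_rV_box.
  + by move=> y _; rewrite lee_fin powR_ge0.
  + apply/measurable_funTS/measurable_EFinP; exact: measurable_halfspace_weight.
  + move=> y /= /(_ ord_max); rewrite /I/= in_itv/= => /andP[h _].
    have rhoy : rho <= last_coord y.
      by apply: le_trans h; rewrite lerDr; exact: ltW.
    rewrite halfspace_weightE; last exact: lt_le_trans rhoy.
    rewrite lee_fin; apply: ge0_ler_powR => //; rewrite nnegrE ?ltW//.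
    exact: lt_le_trans rhoy.
Qed.

(** * Finiteness of the weighted norm for compactly supported functions *)

Lemma compact_continuous_bound (R : realType) (T : topologicalType)
    (A : set T) (f : T -> R) :
  compact A -> {in A, continuous f} ->
  exists2 M : R, 0 <= M & forall x, A x -> `|f x| <= M.
Proof.
move=> cA cf; have [->|/set0P A0] := eqVneq A set0; first by exists 0.
have [|c cAc fc] := @compact_EVT_max _ _ (fun x => `|f x|) _ A0 cA.
  apply: continuous_in_subspaceT => x Ax.
  by apply: (continuous_comp (cf x Ax)); exact: norm_continuous.
by exists `|f c| => // x Ax; apply: fc; rewrite inE.
Qed.

Lemma continuous_last_coord_powR (R : realType) n (a : R) (x : 'rV[R]_n.+1) :
  halfspace n x -> {for x, continuous (fun y => last_coord y `^ a)}.
Proof.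
move=> Hx; apply: (@continuous_comp _ _ _ (@last_coord R n) (fun t => t `^ a)).
  exact: coord_continuous.
apply/differentiable_continuous/derivable1_diffP.
by have [] := is_derive1_powR a Hx.
Qed.

Lemma compact_subset_rV_box (R : realType) n (A : set 'rV[R]_n) : compact A ->
  exists2 B : set 'rV[R]_n,
    measurable B /\ (lebesgue_rV n B < +oo)%E & A `<=` B.
Proof.
(* Boundedness gives a norm bound by every real strictly above M; M + 1 is one. *)
move=> /compact_bounded[M [_ /(_ (M + 1))]]; rewrite ltrDl ltr01 => /(_ isT) AM.
pose I (i : 'I_n) : set (measurableTypeR R) := `[- (M + 1), M + 1]%classic.
have mI i : measurable (I i) by exact: measurable_itv.
exists [set x | forall i, I i (x ord0 i)]; first split.
- exact: measurable_rV_box.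
- rewrite (lebesgue_rV_box mI).
  under eq_bigr => i _.
    rewrite -[lebesgue_measure _]fineK; last first.
      by rewrite /I lebesgue_measure_itv/=; case: ifP.
    over.
  by rewrite prodEFin ltry.
- move=> x /AM/= xM i; rewrite /I/= in_itv/= -ler_norml.
  apply: le_trans xM.
  rewrite [leRHS]mx_normrE.
  exact: (le_bigmax _ (fun i : 'I_1 * 'I_n => `|x i.1 i.2|) (ord0, i)).
Qed.

Lemma smooth_continuous (R : realType) n (f : 'rV[R]_n.+1 -> R) :
  smooth f -> continuous f.
Proof. by move=> /(_ [::])[]. Qed.

(** The support is a compact subset of the open half-space, so x_n^a f and x_n^s are continuous and
    bounded on it, whatever the signs of a and s. The integrand is dominated by M^q N on a box of
    finite volume, and off the support it is 0 since q > 0. *)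
Lemma weighted_norm_lty (R : realType) n (a s q : R) (f : 'rV[R]_n.+1 -> R) :
  0 < q -> Cc_infty (halfspace n) f ->
  (\int[lebesgue_rV n.+1]_x
    (`|last_coord x `^ a * f x| `^ q * halfspace_weight s x)%:E < +oo)%E.
Proof.
move=> q0 [/smooth_continuous cf cK KH].
have [M M0 fM] : exists2 M : R, 0 <= M &
    forall x, supp f x -> `|last_coord x `^ a * f x| <= M.
  apply: compact_continuous_bound => // x; rewrite inE => Kx.
  apply: (@continuousM _ _ (fun y => last_coord y `^ a) f); last exact: cf.
  by apply: continuous_last_coord_powR; exact: KH.
have [N N0 wN] : exists2 N : R, 0 <= N &
    forall x, supp f x -> `|last_coord x `^ s| <= N.
  apply: compact_continuous_bound => // x; rewrite inE => Kx.
  by apply: continuous_last_coord_powR; exact: KH.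
have [B [mB Boo] KB] := compact_subset_rV_box _ _ _ cK.
set F := (F in (\int[_]_x F x < _)%E).
have mF : measurable_fun setT F.
  apply/measurable_EFinP; apply: measurable_funM;
    last exact: measurable_halfspace_weight.
  apply: (measurableT_comp (measurable_powR q)); apply: measurableT_comp => //.
  apply: measurable_funM; last exact: continuous_measurable_rV.
  exact: (measurableT_comp (measurable_powR a) (measurable_last_coord _ _)).
have F0 x : (0 <= F x)%E.
  by rewrite lee_fin mulr_ge0 ?powR_ge0 ?halfspace_weight_ge0.
apply: (@le_lt_trans _ _
  (\int[lebesgue_rV n.+1]_x ((M `^ q * N) * \1_B x)%:E)%E).
  apply: ge0_le_integral => //.
  - by move=> x _; exact: F0.
  - apply/measurable_EFinP; apply: measurable_funM => //.
  move=> x _; rewrite lee_fin.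
  have [Kx|Kx] := pselect (supp f x); last first.
    have -> : f x = 0.
      apply/eqP; apply: contrapT => /negP fx.
      by apply: Kx; exact: subset_closure.
    by rewrite mulr0 normr0 powR0 ?gt_eqF// mul0r !mulr_ge0 ?powR_ge0.
  rewrite indicE mem_set ?mulr1; last exact: KB.
  rewrite halfspace_weightE; last exact: KH.
  apply: ler_pM; rewrite ?powR_ge0//.
    by apply: ge0_ler_powR; rewrite ?nnegrE ?(ltW q0)//; exact: fM.
  exact: le_trans (ler_norm _) (wN _ Kx).
under eq_integral do rewrite EFinM.
rewrite ge0_integralZl_EFin ?mulr_ge0 ?powR_ge0//; last first.
  by apply/measurable_EFinP; exact: measurable_indic.
rewrite integral_indic// setIT.
by rewrite lte_mul_pinfty// lee_fin mulr_ge0 ?powR_ge0.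
Qed.

(** * Reduction of the half-space inequality to the weighted one *)

(** Dividing by x_n^((1 - alpha) / 2) is multiplying by x_n^s, and n + 1 + alpha = (n + 1 + s) + (1
    + s). Outside the product of half-spaces one of the weights vanishes. *)
Lemma J_halfspaceE (R : realType) n (alpha p : R) (f : 'rV[R]_n.+1 -> R) :
  let s := (alpha - 1) / 2 in
  let g x := last_coord x `^ ((1 - alpha) / p) * f x in
  J_halfspace alpha p f =
  (\int[lebesgue_rV n.+1 \x lebesgue_rV n.+1]_z
    (`|g z.1 - g z.2| `^ p / enorm (z.1 - z.2) `^ (n.+1%:R + s + (1 + s))
      * halfspace_weight s z.1 * halfspace_weight s z.2)%:E)%E.
Proof.
move=> s g; rewrite /J_halfspace integral_mkcond; apply: eq_integral => z _.
rewrite patchE; case: ifPn => [|/negP Hz].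
  rewrite inE => -[H1 H2]; rewrite !halfspace_weightE// -!powRN.
  by congr (_ * _ `^ _ * _ `^ _ * _ `^ _)%:E; rewrite /s; field.
have [H1|H1] := pselect (halfspace n z.1); last first.
  by rewrite (halfspace_weight_out _ _ _ _ H1) mulr0 mul0r.
rewrite (halfspace_weight_out _ _ _ z.2) ?mulr0// => H2.
by apply: Hz; rewrite inE.
Qed.

(* The dimension is n.+1, so that it ranges over the positive integers. *)
Theorem theorem2p2 (R : realType) (n : nat) (p alpha : R) :
  2 <= p ->
  1 < alpha < Num.min n.+1%:R p ->
  let pstar := n.+1%:R * p / (n.+1%:R - alpha) in
  let q := p * ((n.+1%:R + (alpha - 1) / 2) / (n.+1%:R - 1)) in
  exists d : R, 0 < d /\
    forall f : 'rV[R]_n.+1 -> R, Cc_infty (halfspace n) f ->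
      (J_halfspace alpha p f >=
       d%:E *
       (\int[lebesgue_rV n.+1]_(x in halfspace n)
          (`|f x| `^ q *
           last_coord x `^ (- n.+1%:R + n.+1%:R * q / pstar))%:E)
       `^ (p / q))%E.
Proof.
move=> p2 /andP[alpha1]; rewrite lt_min => /andP[alphan alphap] pstar q.
have p0 : 0 < p by lra.
have n1 : 0 < n.+1%:R - 1 :> R by lra.
set m : R := n.+1%:R in pstar q alphan n1 *.
pose s := (alpha - 1) / 2.
pose D := m + s.
pose sigma := 1 + s.
have s0 : 0 < s by rewrite /s; lra.
have sigma0 : 0 < sigma by rewrite /sigma; lra.
have sigmaD : sigma < D by rewrite /sigma /D; lra.
(* D - sigma = m - 1, so the given q is the Sobolev exponent for D and sigma. *)
have qE : q = p * (D / (D - sigma)).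
  by rewrite /q; congr (_ * (_ / _)); rewrite /D /sigma; ring.
have q0 : 0 < q by rewrite qE mulr_gt0 ?divr_gt0 ?subr_gt0// (lt_trans sigma0).
(* This is the constant c in the lower bound on balls given by [halfspace_weight_ball]. *)
have k0 : 0 < (2 * Num.sqrt n.+1%:R)^-1 `^ D :> R.
  by rewrite powR_gt0// invr_gt0 mulr_gt0// sqrtr_gt0.
have [e [e0 He]] := fractional_sobolev (@lebesgue_rV R n.+1)
  (halfspace_weight s) (fun z => enorm (z.1 - z.2)) _ D sigma p
  (measurable_halfspace_weight _ _ _) (halfspace_weight_ge0 _ _ _)
  (measurable_enormB _ _) k0 p0 sigma0 sigmaD
  (fun x r => halfspace_weight_ball _ _ _ x r (ltW s0)).
exists e; split => // f cf; rewrite J_halfspaceE.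
pose g (x : 'rV[R]_n.+1) := last_coord x `^ ((1 - alpha) / p) * f x.
have mg : measurable_fun setT g.
  apply: measurable_funM.
    exact: (measurableT_comp (measurable_powR _) (measurable_last_coord _ _)).
  by apply: continuous_measurable_rV; case: cf => /smooth_continuous.
(* The exponents of x_n agree, q (1 - alpha) / p + s = - m + m q / pstar, because m q / pstar = q (m
   - alpha) / p and q (m - 1) / p = m + s. *)
have IE : (\int[lebesgue_rV n.+1]_(x in halfspace n)
    (`|f x| `^ q * last_coord x `^ (- m + m * q / pstar))%:E =
    \int[lebesgue_rV n.+1]_x (`|g x| `^ q * halfspace_weight s x)%:E)%E.
  rewrite integral_mkcond; apply: eq_integral => x _.
  rewrite patchE; case: ifPn => [|/negP Hx]; last first.
    by rewrite halfspace_weight_out ?mulr0// => Hx'; apply: Hx; rewrite inE.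
  rewrite inE => Hx; rewrite halfspace_weightE//.
  rewrite /g normrM ger0_norm ?powR_ge0// powRM ?powR_ge0// -powRrM.
  congr EFin; rewrite [RHS]mulrAC [RHS]mulrC; congr (_ * _).
  rewrite -powRD_gt0//.
  congr powR; rewrite /pstar /q /s; field.
  by rewrite !gt_eqF ?subr_gt0//; lra.
by rewrite IE qE; apply: He => //; rewrite -qE; exact: weighted_norm_lty.
Qed.
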